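(* Let $\Omega$ be a bounded domain in $\mathbb{H}$ with boundary of class $C^1$. Let $f=f_1+f_2j:\Omega\to\mathbb{H}$ be a harmonic function on $\Omega$, of class $C^1$ on $\overline\Omega$. Then $f$ is (left-)regular on $\Omega$ (in the sense of Fueter) if and only if $(N-jT)f=0$ on $\partial\Omega$.
   Context: Let $\mathbb{H}$ be the quaternions, with basic units $i,j,k$. Identify $\mathbb{C}^2$ with $\mathbb{H}$ by $(z_1,z_2)=(x_0+ix_1,x_2+ix_3)\mapsto q=z_1+z_2j=x_0+ix_1+jx_2+kx_3$; then $aj=j\bar a$ for $a\in\mathbb{C}$. An $\mathbb{H}$-valued function is written $f=f_1+f_2j$ with $f_1,f_2$ complex-valued. Harmonic means harmonic with respect to the Laplacian of $\mathbb{R}^4$ (componentwise). A $C^1$ function $f$ is (left-)regular on $\Omega$ if $\mathcal Df=0$ on $\Omega$, where $\mathcal D=\frac{\partial}{\partial x_0}+i\frac{\partial}{\partial x_1}+j\frac{\partial}{\partial x_2}+k\frac{\partial}{\partial x_3}$ (units multiplying on the left). $\Omega=\{\rho<0\}$ with $\rho$ a real function of class $C^1$ on $\mathbb{C}^2$ and $d\rho\neq0$ on $\partial\Omega$. The operators $N$ and $T$ are $$N=\frac{\partial\rho}{\partial z_1}\frac{\partial}{\partial\bar z_1}+\frac{\partial\rho}{\partial\bar z_2}\frac{\partial}{\partial z_2},\qquad T=\frac{\partial\rho}{\partial z_2}\frac{\partial}{\partial\bar z_1}-\frac{\partial\rho}{\partial\bar z_1}\frac{\partial}{\partial z_2}.$$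 They act on $f=f_1+f_2j$ by $N(f)=N(f_1)+N(f_2)j$ and $T(f)=T(f_1)+T(f_2)j$, and $jT(f)$ is the quaternionic product of $j$ with $T(f)$. *)

(* Defs.v *)
From HB Require Import structures.
From mathcomp Require Import all_boot all_order all_algebra.
From mathcomp Require Import all_classical all_reals all_analysis.
From mathcomp Require Import complex ring.

Set Implicit Arguments.
Unset Strict Implicit.
Unset Printing Implicit Defensive.

Import Order.TTheory GRing.Theory Num.Theory.
Import numFieldNormedType.Exports.

Local Open Scope classical_set_scope.
Local Open Scope ring_scope.
Local Open Scope complex_scope.

(* x0 + i x1 + j x2 + k x3 is the row vector (x0, x1, x2, x3); the norm is the
   sup norm of row vectors, so only the topology, the notion of boundedness and
   the real differential calculus of R^4 are meaningful, which is all we use. *)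
Definition quat (R : realType) : Type := 'rV[R]_4.

HB.instance Definition _ (R : realType) := NormedModule.on (quat R).

Section Quaternions.
Variable R : realType.
Implicit Types (p q : quat R) (a : R[i]) (l : 'I_4).

Definition coord l q : R := (q : 'rV[R]_4) 0 l.

Definition mkquat (x0 x1 x2 x3 : R) : quat R :=
  \row_(l < 4) [:: x0; x1; x2; x3]`_l.

Definition qmul p q : quat R :=
  let p0 := coord 0 p in let p1 := coord 1 p in
  let p2 := coord 2 p in let p3 := coord 3 p in
  let q0 := coord 0 q in let q1 := coord 1 q in
  let q2 := coord 2 q in let q3 := coord 3 q in
  mkquat (p0 * q0 - p1 * q1 - p2 * q2 - p3 * q3)
         (p0 * q1 + p1 * q0 + p2 * q3 - p3 * q2)
         (p0 * q2 - p1 * q3 + p2 * q0 + p3 * q1)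
         (p0 * q3 + p1 * q2 - p2 * q1 + p3 * q0).

Lemma quatP p q : (forall l, coord l p = coord l q) -> p = q.
Proof. by move=> pq; apply/rowP => l; exact: pq. Qed.

Lemma coordD l p q : coord l (p + q) = coord l p + coord l q.
Proof. by rewrite /coord mxE. Qed.

Lemma coord_mkquat x0 x1 x2 x3 :
  (coord 0 (mkquat x0 x1 x2 x3) = x0) * (coord 1 (mkquat x0 x1 x2 x3) = x1) *
  (coord 2 (mkquat x0 x1 x2 x3) = x2) * (coord 3 (mkquat x0 x1 x2 x3) = x3).
Proof. by rewrite /coord /mkquat; do !split; rewrite mxE. Qed.

Lemma quat4P p q :
  coord 0 p = coord 0 q -> coord 1 p = coord 1 q ->
  coord 2 p = coord 2 q -> coord 3 p = coord 3 q -> p = q.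
Proof.
move=> e0 e1 e2 e3; apply: quatP => -[[|[|[|[|//]]]] i4].
- by rewrite (_ : Ordinal i4 = 0)//; apply: val_inj.
- by rewrite (_ : Ordinal i4 = 1)//; apply: val_inj.
- by rewrite (_ : Ordinal i4 = 2)//; apply: val_inj.
- by rewrite (_ : Ordinal i4 = 3)//; apply: val_inj.
Qed.

Lemma qmulA : associative qmul.
Proof. by move=> p q r; apply: quat4P; rewrite /qmul !coord_mkquat; ring. Qed.

Lemma qmul1l : left_id (mkquat 1 0 0 0) qmul.
Proof. by move=> q; apply: quat4P; rewrite /qmul !coord_mkquat; ring. Qed.

Lemma qmul1r : right_id (mkquat 1 0 0 0) qmul.
Proof. by move=> q; apply: quat4P; rewrite /qmul !coord_mkquat; ring. Qed.

Lemma qmulDl : left_distributive qmul +%R.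
Proof.
move=> p q r; apply: quat4P;
  by rewrite /qmul !(coordD, coord_mkquat); ring.
Qed.

Lemma qmulDr : right_distributive qmul +%R.
Proof.
move=> p q r; apply: quat4P;
  by rewrite /qmul !(coordD, coord_mkquat); ring.
Qed.

Lemma quat1_neq0 : mkquat 1 0 0 0 != 0 :> quat R.
Proof.
apply/eqP => /(congr1 (coord 0)) /eqP.
by rewrite coord_mkquat /coord mxE oner_eq0.
Qed.

HB.instance Definition _ := GRing.Zmodule_isNzRing.Build (quat R)
  qmulA qmul1l qmul1r qmulDl qmulDr quat1_neq0.

Definition qi : quat R := mkquat 0 1 0 0.
Definition qj : quat R := mkquat 0 0 1 0.
Definition qk : quat R := mkquat 0 0 0 1.

Definition quat_of_complex a : quat R := mkquat (complex.Re a) (complex.Im a) 0 0.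

(* The complex components of q = z1 + z2 j. *)
Definition z1 q : R[i] := coord 0 q +i* coord 1 q.
Definition z2 q : R[i] := coord 2 q +i* coord 3 q.

Lemma quat_splitE q :
  q = quat_of_complex (z1 q) + quat_of_complex (z2 q) * qj.
Proof.
apply: quat4P; rewrite coordD /GRing.mul/= /qmul;
  by rewrite !coord_mkquat /=; ring.
Qed.

Lemma quat_of_complex_mulj a :
  quat_of_complex a * qj = qj * quat_of_complex (a^*)%C.
Proof.
case: a => x y; rewrite /GRing.mul/=.
by apply: quat4P; rewrite /qmul !coord_mkquat /=; ring.
Qed.

End Quaternions.

Section Smoothness.
Variables (R : realType) (V : normedModType R).
Implicit Types (U Omega : set (quat R)) (u : quat R -> V) (l : 'I_4).

Definition basis_vector l : quat R := delta_mx 0 l.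

(* The partial derivative with respect to x_l. *)
Definition partial l u : quat R -> V := 'D_(basis_vector l) u.

Definition C1_on U u : Prop :=
  (forall p, U p -> differentiable u p) /\
  (forall l p, U p -> {for p, continuous (partial l u)}).

Definition C2_on U u : Prop :=
  C1_on U u /\ forall l, C1_on U (partial l u).

Definition laplacian u (p : quat R) : V :=
  \sum_(l < 4) partial l (partial l u) p.

Definition harmonic_on U u : Prop :=
  C2_on U u /\ forall p, U p -> laplacian u p = 0.

Definition extends_to_closure Omega u : Prop :=
  exists2 v : quat R -> V,
    {within closure Omega, continuous v} & forall p, Omega p -> v p = u p.

(* Class C^1 on the closure of the open set Omega: u is C^1 on Omega, and u and
   its first partial derivatives extend continuously to the closure.  The values
   of u outside Omega are irrelevant. *)
Definition C1_on_closure Omega u : Prop :=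
  [/\ C1_on Omega u, extends_to_closure Omega u &
      forall l, extends_to_closure Omega (partial l u)].

(* The value at p, in the closure of Omega, of the continuous extension of
   the partial derivative taken in Omega. *)
Definition partial_closure Omega l u (p : quat R) : V :=
  lim (partial l u x @[x --> within Omega (nbhs p)]).

End Smoothness.

Section Domains.
Variable R : realType.
Implicit Types Omega : set (quat R).

Definition domain Omega : Prop :=
  [/\ open Omega, connected Omega & Omega !=set0].

Definition boundary Omega : set (quat R) := closure Omega `\` Omega°.

Definition C1_defining_function Omega (rho : quat R -> R) : Prop :=
  [/\ C1_on setT rho, Omega = [set p | rho p < 0] &
      forall p, boundary Omega p -> exists v, 'd rho p v != 0].

End Domains.

(* The operators are written in terms of a parameter d, where d l u stands for
   the derivative of the real function u with respect to x_l: it is instantiated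
   by [partial] or, for functions that are only given on Omega and C^1 up to the
   boundary, by [partial_closure Omega]. *)
Section ComplexOperators.
Variable R : realType.
Variable d : 'I_4 -> (quat R -> R) -> quat R -> R.
Implicit Types (g : quat R -> R[i]) (p : quat R).

Definition complex_partial (l : 'I_4) g p : R[i] :=
  d l (fun x => complex.Re (g x)) p +i* d l (fun x => complex.Im (g x)) p.

Definition d_z1 g p : R[i] :=
  (complex_partial 0 g p - 'i%C * complex_partial 1 g p) / 2.
Definition d_z1bar g p : R[i] :=
  (complex_partial 0 g p + 'i%C * complex_partial 1 g p) / 2.
Definition d_z2 g p : R[i] :=
  (complex_partial 2 g p - 'i%C * complex_partial 3 g p) / 2.
Definition d_z2bar g p : R[i] :=
  (complex_partial 2 g p + 'i%C * complex_partial 3 g p) / 2.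

End ComplexOperators.

Section BoundaryOperators.
Variables (R : realType) (Omega : set (quat R)) (rho : quat R -> R).
Implicit Types (g : quat R -> R[i]) (f : quat R -> quat R) (p : quat R).

Let rhoC : quat R -> R[i] := fun x => (rho x)%:C.

Definition opN_complex g p : R[i] :=
  d_z1 (@partial R R) rhoC p * d_z1bar (partial_closure Omega) g p +
  d_z2bar (@partial R R) rhoC p * d_z2 (partial_closure Omega) g p.

Definition opT_complex g p : R[i] :=
  d_z2 (@partial R R) rhoC p * d_z1bar (partial_closure Omega) g p -
  d_z1bar (@partial R R) rhoC p * d_z2 (partial_closure Omega) g p.

Definition componentwise (L : (quat R -> R[i]) -> quat R -> R[i]) f p : quat R :=
  quat_of_complex (L (fun x => z1 (f x)) p) +
  quat_of_complex (L (fun x => z2 (f x)) p) * qj R.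

Definition opN f p : quat R := componentwise opN_complex f p.
Definition opT f p : quat R := componentwise opT_complex f p.

End BoundaryOperators.

Section Fueter.
Variable R : realType.
Implicit Types (U : set (quat R)) (f : quat R -> quat R).

Definition fueter f (p : quat R) : quat R :=
  partial 0 f p + qi R * partial 1 f p + qj R * partial 2 f p
    + qk R * partial 3 f p.

Definition regular_on U f : Prop :=
  C1_on U f /\ forall p, U p -> fueter f p = 0.

End Fueter.

(* Main.v *)
Require Import Defs.
From mathcomp Require Import all_boot all_order all_algebra.
From mathcomp Require Import all_classical all_reals all_analysis.
From mathcomp Require Import complex ring lra.
Import Order.TTheory GRing.Theory Num.Theory.
Import numFieldNormedType.Exports.
Local Open Scope classical_set_scope.
Local Open Scope ring_scope.

(* On the boundary, (N - jT) f is a quarter of the product of the quaternionic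
   conjugate of the gradient of rho with Df, the gradient being nonzero; so the
   boundary condition says that the continuous extension of Df vanishes on the
   boundary.  Every real component of Df is a combination with coefficients 1
   and -1 of first derivatives of real harmonic functions, and such a
   combination satisfies the maximum principle, although f is only C^2: it is
   locally a uniform limit of combinations of difference quotients, which are
   C^2 and harmonic. *)

Set Implicit Arguments.
Unset Strict Implicit.
Unset Printing Implicit Defensive.

(* [vector.coord] would otherwise shadow [Defs.coord]. *)
Local Notation coord := Defs.coord.

(** * Second derivative test for functions of one real variable *)

Section SecondDerivative.
Variable R : realType.
Implicit Types (phi psi : R -> R) (a b : R).

(** The first derivative [psi] is prescribed near 0 because a line through a point of an open set is
    sure to stay in it for small parameters only. *)
Definition has_second_derivative0 phi a : Prop :=
  exists2 psi : R -> R,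
    \forall s \near (0 : R), is_derive (s : R) (1 : R) phi (psi s) &
    is_derive (0 : R) (1 : R) psi a.

Lemma has_second_derivative0D phi1 phi2 a b :
  has_second_derivative0 phi1 a -> has_second_derivative0 phi2 b ->
  has_second_derivative0 (phi1 + phi2) (a + b).
Proof.
move=> [psi1 d1 dd1] [psi2 d2 dd2]; exists (psi1 + psi2).
  by near=> s; apply: is_deriveD; near: s.
exact: is_deriveD.
Unshelve. all: by end_near. Qed.

Lemma has_second_derivative0B phi1 phi2 a b :
  has_second_derivative0 phi1 a -> has_second_derivative0 phi2 b ->
  has_second_derivative0 (phi1 - phi2) (a - b).
Proof.
move=> [psi1 d1 dd1] [psi2 d2 dd2]; exists (psi1 - psi2).
  by near=> s; apply: is_deriveB; near: s.
exact: is_deriveB.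
Unshelve. all: by end_near. Qed.

Lemma has_second_derivative0Z k phi a :
  has_second_derivative0 phi a -> has_second_derivative0 (k \*: phi) (k * a).
Proof.
move=> [psi d dd]; exists (k \*: psi).
  by near=> s; apply: is_deriveZ; near: s.
exact: is_deriveZ.
Unshelve. all: by end_near. Qed.

Lemma has_second_derivative0_sum n (phi : 'I_n -> R -> R) (a : 'I_n -> R) :
  (forall i, has_second_derivative0 (phi i) (a i)) ->
  has_second_derivative0 (\sum_i phi i) (\sum_i a i).
Proof.
move=> phia; elim/big_ind2 : _ => //.
  exists 0; last exact: is_derive_cst.
  by near=> s; exact: is_derive_cst.
by move=> *; exact: has_second_derivative0D.
Unshelve. all: by end_near. Qed.

Lemma has_second_derivative0_quadratic a b k :
  has_second_derivative0 (fun s => a + b * s + k * s ^+ 2) (2 * k).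
Proof.
exists (fun s => b + 2 * k * s).
  near=> s.
  have -> : (fun s : R => a + b * s + k * s ^+ 2) =
            cst a + b \*: id + k \*: (id ^+ 2) by [].
  apply: is_derive_eq => /=.
  by rewrite /GRing.scale/= expr1; ring.
have -> : (fun s : R => b + 2 * k * s) = cst b + (2 * k) \*: id by [].
by apply: is_derive_eq; rewrite /GRing.scale/=; ring.
Unshelve. all: by end_near. Qed.

(** At the maximum [psi 0 = 0], so [a > 0] would make [psi] positive just to the right of 0, and by
    the mean value theorem [phi] would exceed [phi 0] there. *)
Lemma second_derivative0_max phi a :
  (\forall s \near (0 : R), phi s <= phi 0) -> has_second_derivative0 phi a -> a <= 0.
Proof.
move=> max0 [psi dphi dpsi]; rewrite leNgt; apply/negP => a_gt0.
have [e /= e0 He] : exists2 e : R, 0 < e & forall s : R, `|s| < e ->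
    phi s <= phi 0 /\ is_derive s (1 : R) phi (psi s).
  have /nbhs_ballP[e /= e0 He] : nbhs (0 : R) (fun s =>
      phi s <= phi 0 /\ is_derive s (1 : R) phi (psi s)).
    by near=> s; split; near: s.
  by exists e => // s se; apply: He; rewrite -ball_normE /= sub0r normrN.
have psi0 : psi 0 = 0.
  have dmax : is_derive (0 : R) 1 phi 0.
    apply: (@derive1_at_max _ phi (- e) e).
    - lra.
    - move=> t; rewrite in_itv/= => te.
      by have [|_ []] // := He t; rewrite ltr_norml.
    - by rewrite in_itv/= e0 oppr_lt0 e0.
    - by move=> t; rewrite in_itv/= => te; have [|] // := He t; rewrite ltr_norml.
  have [_ d0] := He 0 ltac:(by rewrite normr0).
  by rewrite -(@derive_val _ _ _ _ _ _ _ d0) (@derive_val _ _ _ _ _ _ _ dmax).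
have [dv dE] := dpsi.
(* With [a] itself as tolerance, the difference quotients of [psi] at 0 are eventually positive. *)
have /cvgrPdist_lt/(_ a a_gt0) : (fun h : R => h^-1 *: (psi (h *: 1 + 0) - psi 0))
    @ 0^' --> a by rewrite -dE; exact: dv.
rewrite near_withinE => /nbhs_ballP[d /= d0 Hd].
have psi_gt0 s : 0 < s -> s < d -> 0 < psi s.
  move=> s0 sd; have := Hd s.
  rewrite -ball_normE /= sub0r normrN gtr0_norm// => /(_ sd).
  rewrite gt_eqF// => /(_ isT).
  rewrite /GRing.scale/= mulr1 addr0 psi0 subr0 ltr_norml => /andP[_].
  by rewrite ltrBlDr ltrDl pmulr_rgt0// invr_gt0.
pose s := Num.min d e / 2.
have m0 : 0 < Num.min d e by rewrite lt_min d0 e0.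
have s0 : 0 < s by rewrite divr_gt0.
have /andP[sd se] : (s < d) && (s < e).
  by rewrite -lt_min /s ltr_pdivrMr// mulr_natr mulr2n ltrDl.
have [||c cs eqc] := @MVT R phi psi 0 s s0.
  - move=> x; rewrite in_itv/= => /andP[x0 xs].
    by have [|_ ]// := He x; rewrite gtr0_norm// (lt_trans xs).
  - apply: derivable_within_continuous => x; rewrite in_itv/= => /andP[x0 xs].
  by have [|_ []]// := He x; rewrite ger0_norm// (le_lt_trans xs).
move: cs; rewrite in_itv/= => /andP[c0 cs].
have [|+ _] := He s; first by rewrite gtr0_norm.
rewrite -subr_le0 eqc subr0 pmulr_lle0// leNgt psi_gt0//.
exact: lt_trans sd.
Unshelve. all: by end_near. Qed.

End SecondDerivative.

(** * Restriction to coordinate lines, and the Euclidean square norm *)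

Section Lines.
Variable R : realType.
Implicit Types (Omega : set (quat R)) (h : quat R -> R) (x : quat R) (l : 'I_4).

Lemma is_derive_line (V : normedModType R) (h : V -> R) (x v : V) (s d : R) :
  is_derive (x + s *: v) v h d ->
  is_derive s (1 : R) (fun t : R => h (x + t *: v)) d.
Proof.
move=> [dv dE].
have E : (fun k : R => k^-1 *: (((fun t : R => h (x + t *: v)) \o shift s) (k *: 1)
             - h (x + s *: v))) =
         (fun k : R => k^-1 *: ((h \o shift (x + s *: v)) (k *: v) - h (x + s *: v))).
  apply/funext => k /=; congr (_ *: (h _ - _)).
  by rewrite scalerDl [k *: 1]mulr1 addrCA.
by split; [rewrite /derivable E|rewrite /derive E].
Qed.

Lemma normr_basis_vector l : `|basis_vector R l| <= 1.
Proof.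
rewrite [leLHS]/Num.Def.normr/= mx_normrE (bigmax_le _ ler01)//= => -[i j] _.
by rewrite /basis_vector mxE; case: (_ && _); rewrite ?normr1 ?normr0.
Qed.

Lemma coord_basis_vector l m : coord m (basis_vector R l) = (m == l)%:R.
Proof. by rewrite /coord /basis_vector mxE eqxx. Qed.

Lemma ball_line x y l (e s : R) :
  `|x - y| + `|s| < e -> ball x e (y + s *: basis_vector R l).
Proof.
move=> xye; rewrite -ball_normE /= opprD addrA.
rewrite (le_lt_trans (ler_normB _ _))// (le_lt_trans _ xye)// lerD2l normrZ.
by rewrite ler_piMr ?normr_basis_vector.
Qed.

Lemma near_line (U : set (quat R)) x l :
  nbhs x U -> \forall s \near (0 : R), U (x + s *: basis_vector R l).
Proof.
move=> /nbhs_ballP[e /= e0 eU]; apply/nbhs_ballP; exists e => //= s.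
rewrite -ball_normE /= sub0r normrN => se; apply: eU; apply: ball_line.
by rewrite subrr normr0 add0r.
Qed.

Lemma is_derive_partial Omega h x l : C1_on Omega h -> Omega x ->
  is_derive x (basis_vector R l) h (partial l h x).
Proof. by move=> [dh _] Ox; split=> //; apply: diff_derivable; exact: dh. Qed.

Lemma has_second_derivative0_line Omega h x l :
  open Omega -> C2_on Omega h -> Omega x ->
  has_second_derivative0 (fun s : R => h (x + s *: basis_vector R l))
    (partial l (partial l h) x).
Proof.
move=> oO [C1h C2h] Ox.
exists (fun s : R => partial l h (x + s *: basis_vector R l)).
  have := @near_line Omega x l (open_nbhs_nbhs (conj oO Ox)).
  apply: filterS => s Os; apply: is_derive_line.
  exact: is_derive_partial C1h Os.
apply: is_derive_line; rewrite scale0r addr0.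
exact: is_derive_partial (C2h l) Ox.
Qed.

(** The Euclidean square norm replaces the sup norm of [quat R] wherever a smooth function with
    positive Laplacian is wanted. *)
Definition sqnorm x : R := \sum_(l < 4) coord l x ^+ 2.

Lemma sqnorm_line x l (s : R) :
  sqnorm (x + s *: basis_vector R l) = sqnorm x + 2 * coord l x * s + s ^+ 2.
Proof.
have coordE i : coord i (x + s *: basis_vector R l) = coord i x + s * (i == l)%:R.
  rewrite coordD -coord_basis_vector; congr (_ + _).
  by rewrite /coord !mxE.
rewrite /sqnorm (bigD1 l)//= [\sum_i coord i x ^+ 2](bigD1 l)//= coordE eqxx mulr1.
rewrite (eq_bigr (fun i => coord i x ^+ 2)); first by ring.
by move=> i /negbTE il; rewrite coordE il mulr0 addr0.
Qed.

Lemma sqnorm0 : sqnorm 0 = 0.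
Proof.
by rewrite /sqnorm big1// => l _; rewrite /coord mxE expr0n.
Qed.

(** The sup norm is attained at some coordinate, whose square is one of the summands. *)
Lemma sqr_normr_le_sqnorm x : `|x| ^+ 2 <= sqnorm x.
Proof.
have [->|x0] := eqVneq x 0.
  by rewrite sqnorm0 normr0 expr0n.
have : exists l, `|x| = `|coord l x|.
  rewrite [`|x|]/Num.Def.normr/= mx_normrE.
  have [[i j] _ ->] := eq_bigmax (x := 0) (ord0, ord0) xpredT
    (fun ij : 'I_1 * 'I_4 => `|(x : 'rV_4) ij.1 ij.2|) isT (fun _ _ => normr_ge0 _).
  by exists j; rewrite ord1.
move=> [l ->]; rewrite real_normK ?num_real// /sqnorm (bigD1 l)//= lerDl.
by apply: sumr_ge0 => i _; exact: sqr_ge0.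
Qed.

Lemma continuous_coord l : continuous (@coord R l).
Proof. by move=> x; exact: coord_continuous. Qed.

Lemma continuous_sqnorm : continuous sqnorm.
Proof.
apply: continuous_big => [|l _ x]; first exact: add_continuous.
have cx := @continuous_coord l x.
exact: (cvgM cx cx).
Qed.

End Lines.

(** * Absence of interior maxima for combinations of first derivatives of harmonic functions *)

Section MaximumPrinciple.
Variable R : realType.
Implicit Types (Omega K : set (quat R)) (x p : quat R) (l : 'I_4).

(** The mean value theorem turns the quotient into the partial derivative at a point of the segment.
    By continuity this value and the one at [x] are both [eta / 2]-close to the one at a nearby
    [x0], and compactness of [K] makes the range of [t] uniform. *)
Lemma difference_quotient_unif Omega K (h : quat R -> R) l (eta : R) :
  open Omega -> C1_on Omega h -> compact K -> K `<=` Omega -> 0 < eta ->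
  \forall t \near (0 : R)^'+, K `<=` [set x |
    Omega (x + t *: basis_vector R l) /\
    `|t^-1 * (h (x + t *: basis_vector R l) - h x) - partial l h x| <= eta].
Proof.
move=> oO C1h cK KO eta0.
apply: ((compact_near_coveringP K).1 cK) => x0 Kx0.
have [d d0 Hd] : exists2 d : R, 0 < d & forall y, ball x0 d y ->
    Omega y /\ `|partial l h x0 - partial l h y| < eta / 2.
  have dh : partial l h y @[y --> x0] --> partial l h x0 by exact: C1h.2 (KO _ Kx0).
  have /nbhs_ballP[d /= d0 Hd] : \forall y \near x0,
      Omega y /\ `|partial l h x0 - partial l h y| < eta / 2.
    near=> y; split; near: y; first by apply: open_nbhs_nbhs; split=> //; exact: KO.
    by move/cvgrPdist_lt : dh; apply; rewrite divr_gt0.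
  by exists d.
have d20 : 0 < d / 2 by rewrite divr_gt0.
(* Halving [d] keeps the whole segment from [x] to its translate inside [ball x0 d]. *)
exists (ball x0 (d / 2), [set t : R | 0 < t < d / 2]).
  split; first exact: nbhsx_ballx.
  by near=> t => /=; apply/andP; split; near: t;
    [exact: nbhs_right_gt|exact: nbhs_right_lt].
move=> [x t] /= [x0x /andP[t0 td]].
have line s : 0 <= s -> s <= t -> ball x0 d (x + s *: basis_vector R l).
  move=> s0 st; apply: ball_line; move: x0x; rewrite -ball_normE /= => x0x.
  rewrite ger0_norm// [ltRHS]splitr ltr_leD// (le_trans st)// ltW//.
have [Oxt _] := Hd _ (line t (ltW t0) (lexx t)).
split=> //.
have dphi s : 0 <= s -> s <= t -> is_derive s (1 : R)
    (fun s : R => h (x + s *: basis_vector R l))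
    (partial l h (x + s *: basis_vector R l)).
  move=> s0 st; apply: is_derive_line.
  exact: is_derive_partial C1h (Hd _ (line s s0 st)).1.
have [||c] := @MVT R (fun s : R => h (x + s *: basis_vector R l))
    (fun s : R => partial l h (x + s *: basis_vector R l)) 0 t t0.
- by move=> s; rewrite in_itv/= => /andP[s0 st]; apply: dphi; exact: ltW.
- apply: derivable_within_continuous => s; rewrite in_itv/= => /andP[s0 st].
  by have [] := dphi s s0 st.
rewrite in_itv/= scale0r addr0 subr0 => /andP[c0 ct] ->.
rewrite mulrCA mulVf ?gt_eqF// mulr1.
have [_ Hc] := Hd _ (line c (ltW c0) (ltW ct)).
have [_ Hx] := Hd _ (line 0 (lexx 0) (ltW t0)).
rewrite scale0r addr0 in Hx.
rewrite -(subrKA (partial l h x0)) (le_trans (ler_normD _ _))//.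
by rewrite (splitr eta) lerD// ltW// distrC.
Unshelve. all: by end_near. Qed.

Lemma C1_on_continuous (V : normedModType R) Omega (h : quat R -> V) x :
  C1_on Omega h -> Omega x -> {for x, continuous h}.
Proof. by move=> [dh _] Ox; apply: differentiable_continuous; exact: dh. Qed.

Lemma continuous_shift (V : normedModType R) (a x : V) :
  {for x, continuous (fun y => y + a)}.
Proof. by apply: cvgD; [exact: cvg_id|exact: cvg_cst]. Qed.

(** A general [T] covers both the space itself and the subspace topology of the closure of
    [Omega]. *)
Lemma continuous_lincomb (T : topologicalType) n (c : 'I_n -> R)
    (g : 'I_n -> T -> R) (x : T) :
  (forall i, {for x, continuous (g i)}) ->
  {for x, continuous (fun y => \sum_i c i * g i y)}.
Proof.
move=> cg; apply: (@cvg_big _ _ _ _ _ add_continuous _ (nbhs x)) => i _.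
by apply: cvgMl_tmp; exact: cg.
Qed.

(* The term [e * sqnorm x] makes the Laplacian positive; subtracting the penalty
   [e / 2 * sqnorm (x - p)] keeps it so and makes the maximum at [p] strict, hence
   stable when the derivatives are replaced with difference quotients, to which
   the second derivative test applies. *)
Lemma no_local_max Omega (h : 'I_4 -> quat R -> R) (c : 'I_4 -> R) p (e d : R) :
  open Omega -> (forall l, harmonic_on Omega (h l)) -> Omega p -> 0 < e -> 0 < d ->
  ~ (forall x, ball p d x ->
       \sum_l c l * partial l (h l) x + e * sqnorm x <=
       \sum_l c l * partial l (h l) p + e * sqnorm p).
Proof.
move=> oO hh Op e0 d0 pmax.
pose u x := \sum_l c l * partial l (h l) x.
have C1h l : C1_on Omega (h l) by have [[]] := hh l.
have [r0 r00 Hr0] : exists2 r : R, 0 < r & ball p r `<=` Omega.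
  have : nbhs p Omega by apply: open_nbhs_nbhs.
  by move=> /nbhs_ballP[r /= r0 Hr]; exists r.
pose r := Num.min d r0 / 2.
have m0 : 0 < Num.min d r0 by rewrite lt_min d0 r00.
have rpos : 0 < r by rewrite divr_gt0.
have /andP[rd rr0] : (r < d) && (r < r0).
  by rewrite -lt_min /r ltr_pdivrMr// mulr_natr mulr2n ltrDl.
pose K : set (quat R) := [set x | `|p - x| <= r].
have Kball (b : R) : r < b -> K `<=` ball p b.
  by move=> rb x Kx; rewrite -ball_normE /=; exact: le_lt_trans rb.
have KO : K `<=` Omega by apply: subset_trans Hr0; exact: Kball.
have cK : compact K.
  apply: bounded_closed_compact.
    exists (`|p| + r); split; first exact: num_real.
    move=> M prM x /= Kx; rewrite (le_trans _ (ltW prM))//.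
    by rewrite -[x](subKr p) (le_trans (ler_normB _ _))// lerD2l.
  have -> : K = closed_ball p r by rewrite closed_ballE.
  exact: closed_ball_closed.
(* At sup distance [r] from [p] the penalty is at least [e / 2 * r ^+ 2], that is [4 * eta], whereas
   replacing [u] with [ut] at two points costs at most [2 * eta]. *)
pose eta := e * r ^+ 2 / 8.
have eta0 : 0 < eta by rewrite /eta; apply: divr_gt0 => //; rewrite mulr_gt0// exprn_gt0.
(* After multiplication by [c l], each of the four errors is at most [eta / 4]; the added 1 keeps
   the divisor positive. *)
have [t t0 Ht] : exists2 t : R, 0 < t & forall l x, K x ->
    Omega (x + t *: basis_vector R l) /\
    `|t^-1 * (h l (x + t *: basis_vector R l) - h l x) - partial l (h l) x|
       <= eta / 4 / (`|c l| + 1).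
  near (0 : R)^'+ => t; exists t; first by near: t; exact: nbhs_right_gt.
  near: t; apply: filter_forall => l.
  apply: difference_quotient_unif => //.
  by apply: divr_gt0; [exact: divr_gt0|rewrite ltr_wpDl].
pose q x := e * sqnorm x - e / 2 * sqnorm (x - p).
pose ut x := \sum_l c l * (t^-1 * (h l (x + t *: basis_vector R l) - h l x)).
pose w x := ut x + q x.
have wE x : K x -> `|ut x - u x| <= eta.
  move=> Kx; rewrite /ut /u -sumrB (le_trans (ler_norm_sum _ _ _))//.
  have -> : eta = \sum_(l < 4) eta / 4.
    by rewrite sumr_const card_ord -[RHS]mulr_natr divfK.
  apply: ler_sum => l _; rewrite -mulrBr normrM.
  have c1 : 0 < `|c l| + 1 by rewrite ltr_wpDl.
  have [_ /(ler_wpM2l (normr_ge0 (c l)))/le_trans] := Ht l x Kx; apply.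
  rewrite mulrA ler_pdivrMr// mulrC ler_pM2l; last exact: divr_gt0.
  by rewrite lerDl ler01.
have shiftC (g : quat R -> R) v x :
    {for x + v, continuous g} -> {for x, continuous (fun y => g (y + v))}.
  move=> cg; apply: (@continuous_comp _ _ _ (fun y => y + v) g) => //.
  exact: continuous_shift.
have cut x : K x -> {for x, continuous ut}.
  move=> Kx; apply: continuous_lincomb => l.
  have c1 := C1_on_continuous (C1h l) (KO _ Kx).
  have c2 := shiftC _ _ _ (C1_on_continuous (C1h l) (Ht l x Kx).1).
  exact: (cvgMl_tmp (cvgB c2 c1)).
have cq x : {for x, continuous q}.
  have sq := @continuous_sqnorm R.
  exact: (cvgB (cvgMl_tmp (sq x)) (cvgMl_tmp (shiftC _ (- p) x (sq (x - p))))).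
have cw : {within K, continuous w}.
  apply: continuous_in_subspaceT => x; rewrite inE => Kx.
  exact: (cvgD (cut _ Kx) (cq x)).
have Kp : K p by rewrite /K/= subrr normr0 ltW.
have [|z] := compact_EVT_max _ cK cw; first by exists p.
rewrite inE => Kz zmax.
(* The maximum of [w] is interior to [K]: on the sphere of radius [r] the penalty outweighs the
   approximation error, so [w] is smaller there than at [p]. *)
have zr : `|p - z| < r.
  rewrite ltNge; apply/negP => rz.
  have := zmax p (mem_set Kp); apply/negP; rewrite -ltNge.
  have := pmax z (Kball _ rd _ Kz); rewrite -/(u z) -/(u p).
  have := wE z Kz; have := wE p Kp; rewrite !ler_norml => /andP[p1 p2] /andP[z1 z2].
  have sz : r ^+ 2 <= sqnorm (z - p).
    apply: le_trans (sqr_normr_le_sqnorm _).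
    by rewrite distrC lerXn2r// nnegrE// ltW.
  have := ler_wpM2l (ltW e0) sz.
  have er : 0 < e * r ^+ 2 by rewrite mulr_gt0// exprn_gt0.
  rewrite /w /q subrr sqnorm0 mulr0 subr0.
  move: p1 p2 z1 z2; rewrite /eta; lra.
(* [a l] is the second derivative of [w] at [z] in direction [l]; the coefficient [e / 2] is what
   the penalty leaves of [e]. *)
pose a l := \sum_m c m * (t^-1 *
    (partial l (partial l (h m)) (z + t *: basis_vector R m)
     - partial l (partial l (h m)) z)) + 2 * (e / 2).
have a_le0 l : a l <= 0.
  apply: (@second_derivative0_max R (fun s : R => w (z + s *: basis_vector R l))).
    have : nbhs z K.
      apply/nbhs_ballP; exists (r - `|p - z|); first by rewrite /= subr_gt0.
      move=> y; rewrite -ball_normE /= ltrBrDl => /ltW zy.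
      by rewrite /K/= (le_trans _ zy)// -(subrKA z) ler_normD.
    move=> /(@near_line _ _ _ l); apply: filterS => s Ks.
    by rewrite scale0r addr0; apply: zmax; rewrite inE.
  have -> : (fun s : R => w (z + s *: basis_vector R l)) =
    (\sum_m (c m) \*: (t^-1 \*: (
        (fun s : R => h m (z + t *: basis_vector R m + s *: basis_vector R l))
        - (fun s : R => h m (z + s *: basis_vector R l)))))
    + (fun s : R => q z + (2 * (e * coord l z - e / 2 * coord l (z - p))) * s
         + (e / 2) * s ^+ 2).
    apply/funext => s; rewrite /w /ut /q /= fctE fct_sumE; congr (_ + _).
      by apply: eq_bigr => m _; rewrite [z + s *: _ + _]addrAC.
    rewrite (_ : z + s *: _ - p = z - p + s *: basis_vector R l); last first.
      by rewrite addrAC.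
    by rewrite !sqnorm_line; field.
  apply: has_second_derivative0D; last exact: has_second_derivative0_quadratic.
  apply: has_second_derivative0_sum => m.
  apply: has_second_derivative0Z; apply: has_second_derivative0Z.
  have [C2m _] := hh m.
  apply: has_second_derivative0B.
    by apply: has_second_derivative0_line oO C2m _; have [] := Ht m z Kz.
  by apply: has_second_derivative0_line oO C2m _; exact: KO.
(* Summing over [l] first produces Laplacians of the [h m] at [z] and at its translates, which
   vanish; what remains is four times [e], a contradiction. *)
have : \sum_l a l <= 0 by apply: sumr_le0.
rewrite /a big_split/= exchange_big/= big1 ?add0r.
  by rewrite sumr_const card_ord mulrCA divff// mulr1 pmulrn_rle0// leNgt e0.
move=> m _; rewrite -mulr_sumr -mulr_sumr sumrB.
have [_ lap0] := hh m.
rewrite -!/(laplacian _ _) !lap0 ?subrr ?mulr0//; first exact: KO.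
by have [] := Ht m z Kz.
Unshelve. all: by end_near. Qed.

End MaximumPrinciple.

(** * Passage to real coordinates, and the maximum principle on a bounded open set *)

Section Regularity.
Variable R : realType.
Implicit Types (U Omega : set (quat R)) (f : quat R -> quat R) (l m : 'I_4).

(** The difference [g - f] vanishes near [x], hence has zero differential there, and [g] is [f] plus
    this difference. *)
Lemma near_eq_differentiable (V W : normedModType R) (f g : V -> W) (x : V) :
  (\near x, f x = g x) -> differentiable f x -> differentiable g x.
Proof.
move=> fg df.
have gf0 : \forall h \near (0 : V), (g - f) (h + x) = 0.
  have : \forall y \near (0 : V) + x, f y = g y by rewrite add0r.
  rewrite (near_shift 0) subr0 add0r.
  apply: filterS => h /= fgh.
  by rewrite -[LHS]/(g (h + x) - f (h + x)) fgh subrr.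
have o0 : (g - f) \o shift x = cst ((g - f) x) + (\0 : V -> W) +o_ 0 id.
  apply/eqaddoP => e e0; near=> h.
  have gfh : (g - f) (h + x) = 0 by near: h.
  have gfx : (g - f) x = 0.
    by have := nbhs_singleton gf0; rewrite add0r.
  rewrite [X in `|X|](_ : _ = 0) ?normr0 ?mulr_ge0// ?ltW//.
  rewrite -[LHS]/((g - f) (h + x) - ((g - f) x + 0)).
  by rewrite gfh gfx addr0 subr0.
have d0 : 'd (g - f) x = (\0 : V -> W) :> (V -> W).
  by apply: diff_unique o0 => y; exact: cst_continuous.
have : differentiable (g - f) x.
  by apply/diff_locallyP; rewrite d0; split=> // y; exact: cst_continuous.
by move=> /(differentiableD df); rewrite addrC subrK.
Unshelve. all: by end_near. Qed.

Lemma near_eq_continuous (T T' : topologicalType) (u v : T -> T') (x : T) :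
  (\near x, u x = v x) -> {for x, continuous u} -> {for x, continuous v}.
Proof.
move=> uv cu; rewrite /prop_for /continuous_at -(nbhs_singleton uv).
by apply: cvg_trans cu; apply: near_eq_cvg.
Qed.

Lemma near_open U (P : quat R -> Prop) x :
  open U -> U x -> (forall y, U y -> P y) -> \forall y \near x, P y.
Proof.
by move=> oU Ux UP; have : nbhs x U by [apply: open_nbhs_nbhs]; exact: filterS.
Qed.

Lemma eq_C1_on (V : normedModType R) U (u v : quat R -> V) :
  open U -> (forall y, U y -> u y = v y) -> C1_on U u -> C1_on U v.
Proof.
move=> oU uv [du pu]; split=> [p Up|l p Up].
  by apply: near_eq_differentiable (du p Up); exact: near_open uv.
have E y : U y -> partial l u y = partial l v y.
  by move=> Uy; apply: near_eq_derive; exact: near_open uv.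
exact: near_eq_continuous (near_open oU Up E) (pu l p Up).
Qed.

Lemma partial_coord f p l m : differentiable f p ->
  partial l (fun x => coord m (f x)) p = coord m (partial l f p).
Proof.
move=> df; rewrite /partial.
have := @derive_mx R (quat R) 1 4 f p (basis_vector R l) (diff_derivable df).
by move=> /(congr1 (fun M : 'rV_4 => M 0 m)); rewrite mxE => <-.
Qed.

Lemma C1_on_coord U f m : open U -> C1_on U f -> C1_on U (fun x => coord m (f x)).
Proof.
move=> oU [df pf]; split=> [p Up|l p Up].
  apply: (@differentiable_comp _ _ _ _ f (@coord R m)); first exact: df.
  exact: differentiable_coord.
have E y : U y -> coord m (partial l f y) = partial l (fun x => coord m (f x)) y.
  by move=> Uy; rewrite partial_coord//; exact: df.
apply: near_eq_continuous (near_open oU Up E) _.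
apply: (@continuous_comp _ _ _ (partial l f) (@coord R m)); first exact: pf.
exact: continuous_coord.
Qed.

(** Coordinates commute with a partial derivative at points of differentiability. Since [U] is open,
    this equality holds near each of its points and can be differentiated again. *)
Lemma harmonic_on_coord U f m :
  open U -> harmonic_on U f -> harmonic_on U (fun x => coord m (f x)).
Proof.
move=> oU [[C1f C1pf] lap0].
have E l y : U y -> coord m (partial l f y) = partial l (fun x => coord m (f x)) y.
  by move=> Uy; rewrite partial_coord//; exact: C1f.1.
split; first split; first exact: C1_on_coord.
  move=> l; apply: eq_C1_on (C1_on_coord m oU (C1pf l)) => //.
  exact: E.
move=> p Up; have := congr1 (@coord R m) (lap0 p Up).
rewrite /laplacian /coord summxE mxE => {2}<-.
apply: eq_bigr => l _; rewrite -/(coord m _).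
rewrite -(partial_coord _ _ ((C1pf l).1 p Up)); apply: near_eq_derive.
by apply: near_open oU Up _ => y Uy; rewrite E.
Qed.

Lemma boundary_open U : open U -> boundary U = closure U `\` U.
Proof. by move=> oU; rewrite /boundary (interior_id U).1. Qed.

Lemma closure_boundary U p : open U -> closure U p -> U p \/ boundary U p.
Proof.
move=> oU cp; have [Up|nUp] := pselect (U p); first by left.
by right; rewrite boundary_open.
Qed.

Lemma compact_closure_bounded U : bounded_set U -> compact (closure U).
Proof.
move=> [M [_ UM]].
have clM : closure U `<=` closed_ball 0 (`|M| + 1).
  rewrite (closure_id (closed_ball _ _)).1; last exact: closed_ball_closed.
  apply: closureS => x Ux; rewrite closed_ballE ?ltr_wpDl//.
  rewrite /closed_ball_ /= sub0r normrN; apply: UM => //.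
  by rewrite (le_lt_trans (ler_norm M))// ltrDl.
apply: bounded_closed_compact; last exact: closed_closure.
exists (`|M| + 1); split; first exact: num_real.
move=> B MB x /clM; rewrite closed_ballE ?ltr_wpDl//.
by rewrite /closed_ball_ /= sub0r normrN => /le_trans; apply; exact: ltW.
Qed.

(** If [u p0 > 0], a small multiple of [sqnorm] can be added while the value at [p0] stays above all
    boundary values; the maximum over the compact closure is then interior, against
    [no_local_max]. *)
Lemma max_principle Omega (h : 'I_4 -> quat R -> R) (c : 'I_4 -> R)
    (u : quat R -> R) :
  open Omega -> bounded_set Omega -> (forall l, harmonic_on Omega (h l)) ->
  {within closure Omega, continuous u} ->
  (forall x, Omega x -> u x = \sum_l c l * partial l (h l) x) ->
  (forall x, boundary Omega x -> u x <= 0) ->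
  forall x, Omega x -> u x <= 0.
Proof.
move=> oO bO hh cu uE ub p0 Op0; rewrite leNgt; apply/negP => up0.
have cK := compact_closure_bounded bO.
have K0 : closure Omega !=set0 by exists p0; exact: subset_closure.
have [z _ zmax] := compact_EVT_max K0 cK
  (continuous_subspaceT (@continuous_sqnorm R)).
pose B := sqnorm z.
have sqnorm_ge0 x : 0 <= @sqnorm R x by apply: sumr_ge0 => i _; exact: sqr_ge0.
have B0 : 0 <= B by exact: sqnorm_ge0.
(* Chosen so that [e * B < u p0], where [B] is the maximum of [sqnorm] on the closure. *)
pose e := u p0 / (B + 1).
have e0 : 0 < e by rewrite divr_gt0// ltr_wpDl.
have cv : {within closure Omega, continuous (fun x => u x + e * sqnorm x)}.
  move=> x; apply: cvgD; first exact: cu.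
  apply: cvgMl_tmp; exact: (continuous_subspaceT (@continuous_sqnorm R)).
have [p] := compact_EVT_max K0 cK cv; rewrite inE => clp pmax.
have [Op|bp] := closure_boundary oO clp.
  have [d d0 Hd] : exists2 d : R, 0 < d & ball p d `<=` Omega.
    have : nbhs p Omega by apply: open_nbhs_nbhs.
    by move=> /nbhs_ballP[d /= d0 Hd]; exists d.
  apply: (@no_local_max R Omega h c p e d) => // x /Hd Ox.
  by rewrite -!uE//; apply: pmax; rewrite inE; exact: subset_closure.
have := pmax p0 (mem_set (subset_closure Op0)); apply/negP; rewrite -ltNge.
have up := ub _ bp; have := zmax p (mem_set clp).
rewrite -/B => /(ler_wpM2l (ltW e0)) pB.
have eB : e * B < u p0.
  by rewrite /e mulrAC ltr_pdivrMr ?ltr_wpDl// ltr_pM2l// ltrDl.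
have := mulr_ge0 (ltW e0) (sqnorm_ge0 p0); lra.
Qed.

End Regularity.

(** * Boundary values of derivatives, and the quaternionic factorization of the boundary operator *)

Section Boundary.
Variable R : realType.
Implicit Types (Omega : set (quat R)) (f : quat R -> quat R) (w : 'I_4 -> quat R).
Implicit Types (p : quat R) (l m : 'I_4).

Lemma cvg_within_closure (T : topologicalType) Omega (g : quat R -> T) p :
  {within closure Omega, continuous g} -> closure Omega p ->
  g x @[x --> within Omega (nbhs p)] --> g p.
Proof.
move=> cg clp; have := (subspace_continuousP _ _).1 cg p clp.
move=> cgp A /cgp; apply: (@filterS _ (nbhs p)) => x Ax Ox.
by apply: Ax; exact: subset_closure.
Qed.

Lemma cvg_within_eq (T : topologicalType) Omega (g g' : quat R -> T) p (a : T) :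
  (forall x, Omega x -> g x = g' x) ->
  g x @[x --> within Omega (nbhs p)] --> a ->
  g' x @[x --> within Omega (nbhs p)] --> a.
Proof.
move=> gg' ga A /ga; apply: (@filterS _ (nbhs p)) => x Ax Ox.
by rewrite /= -gg'//; exact: Ax.
Qed.

(** The filter of neighbourhoods within [Omega] is proper at a point of the closure, so the limit is
    unique and is given by any continuous extension. *)
Lemma partial_closure_coord Omega f (v : quat R -> quat R) l m p :
  C1_on Omega f -> {within closure Omega, continuous v} ->
  (forall x, Omega x -> v x = partial l f x) -> closure Omega p ->
  partial_closure Omega l (fun x => coord m (f x)) p = coord m (v p).
Proof.
move=> C1f cv vE clp; have PF := within_nbhs_proper clp.
apply: cvg_lim => //.
apply: (@cvg_within_eq _ _ (fun x => coord m (v x))).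
  by move=> x Ox; rewrite vE// partial_coord//; exact: C1f.1.
apply: (@cvg_comp _ _ _ v (@coord R m)); first exact: cvg_within_closure.
exact: continuous_coord.
Qed.

Lemma sum_ord4 (V : nmodType) (F : 'I_4 -> V) :
  \sum_(l < 4) F l = F 0 + F 1 + F 2 + F 3.
Proof.
rewrite !big_ord_recl big_ord0 addr0 !addrA.
by congr (F _ + F _ + F _ + F _); exact: val_inj.
Qed.

(** The Fueter operator as a function of four values, applicable to the extended derivatives at
    boundary points. *)
Definition fueter_form w : quat R :=
  w 0 + qi R * w 1 + qj R * w 2 + qk R * w 3.

Lemma coord_mul (q r : quat R) :
  (coord 0 (q * r) = coord 0 q * coord 0 r - coord 1 q * coord 1 r
    - coord 2 q * coord 2 r - coord 3 q * coord 3 r) *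
  (coord 1 (q * r) = coord 0 q * coord 1 r + coord 1 q * coord 0 r
    + coord 2 q * coord 3 r - coord 3 q * coord 2 r) *
  (coord 2 (q * r) = coord 0 q * coord 2 r - coord 1 q * coord 3 r
    + coord 2 q * coord 0 r + coord 3 q * coord 1 r) *
  (coord 3 (q * r) = coord 0 q * coord 3 r + coord 1 q * coord 2 r
    - coord 2 q * coord 1 r + coord 3 q * coord 0 r).
Proof. by rewrite /GRing.mul/= /qmul; do !split; rewrite !coord_mkquat. Qed.

Lemma ord4_ind (P : 'I_4 -> Prop) : P 0 -> P 1 -> P 2 -> P 3 -> forall l, P l.
Proof.
move=> P0 P1 P2 P3 [[|[|[|[|//]]]] i4].
- by rewrite (_ : Ordinal i4 = 0)//; exact: val_inj.
- by rewrite (_ : Ordinal i4 = 1)//; exact: val_inj.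
- by rewrite (_ : Ordinal i4 = 2)//; exact: val_inj.
- by rewrite (_ : Ordinal i4 = 3)//; exact: val_inj.
Qed.

(** Left multiplication by a basic unit permutes the coordinates up to sign; [c] records the signs
    and [s] the permuted indices, in the shape [max_principle] expects. *)
Lemma coord_fueter_form m : exists (c : 'I_4 -> R) (s : 'I_4 -> 'I_4),
  forall w, coord m (fueter_form w) = \sum_l c l * coord (s l) (w l).
Proof.
move: m; apply: ord4_ind.
- exists (fun l => [:: 1; -1; -1; -1]`_l), (fun l => nth 0 [:: 0; 1; 2; 3] l).
  by move=> w; rewrite sum_ord4 /= !(coordD, coord_mul, coord_mkquat); ring.
- exists (fun l => [:: 1; 1; 1; -1]`_l), (fun l => nth 0 [:: 1; 0; 3; 2] l).
  by move=> w; rewrite sum_ord4 /= !(coordD, coord_mul, coord_mkquat); ring.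
- exists (fun l => [:: 1; -1; 1; 1]`_l), (fun l => nth 0 [:: 2; 3; 0; 1] l).
  by move=> w; rewrite sum_ord4 /= !(coordD, coord_mul, coord_mkquat); ring.
- exists (fun l => [:: 1; 1; -1; 1]`_l), (fun l => nth 0 [:: 3; 2; 1; 0] l).
  by move=> w; rewrite sum_ord4 /= !(coordD, coord_mul, coord_mkquat); ring.
Qed.

Lemma half_addi (a b c d : R) :
  ((Complex a b + 'i * Complex c d) / 2 =
   Complex ((a - d) / 2) ((b + c) / 2))%C.
Proof.
have two0 : (2 : R[i]%C) != 0 by rewrite pnatr_eq0.
apply: (mulIf two0); rewrite divfK// mulr_natr mulr2n.
rewrite -[RHS]/(Complex (_ + _) (_ + _)) -!splitr.
by rewrite -[LHS]/(Complex (a + (0 * c - 1 * d)) (b + (0 * d + 1 * c)));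
  congr (Complex _ _); ring.
Qed.

Lemma half_subi (a b c d : R) :
  ((Complex a b - 'i * Complex c d) / 2 =
   Complex ((a + d) / 2) ((b - c) / 2))%C.
Proof.
have := half_addi a b (- c) (- d); rewrite opprK => <-; congr (_ / _).
by rewrite -[Complex (- c) (- d)]/(- Complex c d)%C mulrN.
Qed.

Lemma d_z1barE (d : 'I_4 -> (quat R -> R) -> quat R -> R) (g : quat R -> R[i]%C) p :
  d_z1bar d g p = Complex
    ((d 0 (fun x => complex.Re (g x)) p - d 1 (fun x => complex.Im (g x)) p) / 2)
    ((d 0 (fun x => complex.Im (g x)) p + d 1 (fun x => complex.Re (g x)) p) / 2).
Proof. exact: half_addi. Qed.

Lemma d_z2E (d : 'I_4 -> (quat R -> R) -> quat R -> R) (g : quat R -> R[i]%C) p :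
  d_z2 d g p = Complex
    ((d 2 (fun x => complex.Re (g x)) p + d 3 (fun x => complex.Im (g x)) p) / 2)
    ((d 2 (fun x => complex.Im (g x)) p - d 3 (fun x => complex.Re (g x)) p) / 2).
Proof. exact: half_subi. Qed.

Lemma mkquatD (a0 a1 a2 a3 b0 b1 b2 b3 : R) :
  mkquat a0 a1 a2 a3 + mkquat b0 b1 b2 b3 =
  mkquat (a0 + b0) (a1 + b1) (a2 + b2) (a3 + b3).
Proof. by apply: quat4P; rewrite coordD !coord_mkquat. Qed.

Lemma mkquatN (a0 a1 a2 a3 : R) :
  - mkquat a0 a1 a2 a3 = mkquat (- a0) (- a1) (- a2) (- a3).
Proof.
apply/esym/eqP; rewrite -addr_eq0 mkquatD !addNr.
by apply/eqP; apply: quat4P; rewrite coord_mkquat /coord mxE.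
Qed.

Lemma mkquatM (a0 a1 a2 a3 b0 b1 b2 b3 : R) :
  mkquat a0 a1 a2 a3 * mkquat b0 b1 b2 b3 =
  mkquat (a0 * b0 - a1 * b1 - a2 * b2 - a3 * b3)
         (a0 * b1 + a1 * b0 + a2 * b3 - a3 * b2)
         (a0 * b2 - a1 * b3 + a2 * b0 + a3 * b1)
         (a0 * b3 + a1 * b2 - a2 * b1 + a3 * b0).
Proof. by apply: quat4P; rewrite coord_mul !coord_mkquat. Qed.

(** Moving [qj] across complex numbers conjugates them, so [j b] becomes [b^* j] and [j a^*] becomes
    [a j]; the remaining term [b^* v] comes from [j j = -1]. *)
Lemma normal_tangential_factor (a b u1 u2 v1 v2 : R[i]%C) :
  quat_of_complex (a * u1 + b^*%C * v1)
  + quat_of_complex (a * u2 + b^*%C * v2) * qj R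
  - qj R * (quat_of_complex (b * u1 - a^*%C * v1)
            + quat_of_complex (b * u2 - a^*%C * v2) * qj R) =
  (quat_of_complex a - quat_of_complex b^*%C * qj R) *
  (quat_of_complex u1 + quat_of_complex u2 * qj R
   + qj R * (quat_of_complex v1 + quat_of_complex v2 * qj R)).
Proof.
case: a b u1 u2 v1 v2 => [a a'] [b b'] [u1 u1'] [u2 u2'] [v1 v1'] [v2 v2'].
rewrite /quat_of_complex /qj /=.
rewrite !(mkquatM, mkquatD, mkquatN).
by congr mkquat; ring.
Qed.

(** As [rho] is real, its derivatives in [z] and in the conjugate variable are conjugate, so the
    factorization applies: its left factor is half the conjugate gradient, its right factor half of
    the extended Df. *)
Lemma boundary_operatorE Omega (rho : quat R -> R) f p :
  opN Omega rho f p - qj R * opT Omega rho f p =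
  mkquat (partial 0 rho p / 2) (- (partial 1 rho p / 2))
         (- (partial 2 rho p / 2)) (- (partial 3 rho p / 2)) *
  (mkquat 2^-1 0 0 0 * fueter_form (fun l => mkquat
    (partial_closure Omega l (fun x => coord 0 (f x)) p)
    (partial_closure Omega l (fun x => coord 1 (f x)) p)
    (partial_closure Omega l (fun x => coord 2 (f x)) p)
    (partial_closure Omega l (fun x => coord 3 (f x)) p))).
Proof.
have partial_cst0 l : partial l (fun=> 0 : R) p = 0 by exact: derive_cst.
pose a := d_z1 (@partial R R) (fun x => (rho x)%:C%C) p.
pose b := d_z2 (@partial R R) (fun x => (rho x)%:C%C) p.
have aE : a = Complex (partial 0 rho p / 2) (- (partial 1 rho p / 2)).
  rewrite /a /d_z1 /complex_partial /= !partial_cst0 half_subi.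
  by rewrite addr0 sub0r mulNr.
have bE : b = Complex (partial 2 rho p / 2) (- (partial 3 rho p / 2)).
  rewrite /b /d_z2 /complex_partial /= !partial_cst0 half_subi.
  by rewrite addr0 sub0r mulNr.
have aC : d_z1bar (@partial R R) (fun x => (rho x)%:C%C) p = a^*%C.
  rewrite aE /d_z1bar /complex_partial /= !partial_cst0 half_addi.
  by rewrite subr0 add0r opprK.
have bC : d_z2bar (@partial R R) (fun x => (rho x)%:C%C) p = b^*%C.
  rewrite bE /d_z2bar /complex_partial /= !partial_cst0 half_addi.
  by rewrite subr0 add0r opprK.
rewrite /opN /opT /componentwise /opN_complex /opT_complex aC bC -/a -/b.
rewrite normal_tangential_factor; congr (_ * _).
  rewrite aE bE /quat_of_complex /qj /= !(mkquatM, mkquatD, mkquatN).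
  by congr mkquat; ring.
rewrite d_z1barE (d_z1barE _ (fun x => z2 (f x))) d_z2E.
rewrite (d_z2E _ (fun x => z2 (f x))) /z1 /z2 /=.
have [w wE] : exists w : 'I_4 -> 'I_4 -> R, forall l m,
    partial_closure Omega l (fun x => coord m (f x)) p = w l m.
  by exists (fun l m => partial_closure Omega l (fun x => coord m (f x)) p).
rewrite /quat_of_complex /fueter_form /qi /qj /qk /=.
rewrite !(mkquatM, mkquatD) !wE.
by congr mkquat; ring.
Qed.

(** Multiplying on the left by the conjugate of the first factor leaves [q] times a nonzero sum of
    squares. *)
Lemma conj_mul_eq0 (r0 r1 r2 r3 : R) (q : quat R) :
  [|| r0 != 0, r1 != 0, r2 != 0 | r3 != 0] ->
  mkquat r0 (- r1) (- r2) (- r3) * q = 0 -> q = 0.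
Proof.
move=> r_neq0 Nq0.
have r_gt0 : r0 ^+ 2 + r1 ^+ 2 + r2 ^+ 2 + r3 ^+ 2 != 0.
  by rewrite !paddr_eq0 ?addr_ge0 ?sqr_ge0// !sqrf_eq0 !negb_and -!orbA.
apply: (scalerI r_gt0); rewrite scaler0 -[RHS](mulr0 (mkquat r0 r1 r2 r3)) -Nq0.
by apply: quat4P; rewrite !coord_mul !coord_mkquat /coord !mxE; ring.
Qed.

(** By linearity the differential is determined by its values on the basis vectors, the partial
    derivatives. *)
Lemma gradient_neq0 (rho : quat R -> R) p (v : quat R) :
  differentiable rho p -> 'd rho p v != 0 ->
  [|| partial 0 rho p != 0, partial 1 rho p != 0,
      partial 2 rho p != 0 | partial 3 rho p != 0].
Proof.
move=> drho; apply: contra_neqT; rewrite !negb_or !negbK.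
move=> /and4P[/eqP r0 /eqP r1 /eqP r2 /eqP r3].
rewrite [v](row_sum_delta (v : 'rV_4)) linear_sum big1// => l _.
rewrite linearZ /= -(deriveE (basis_vector R l) drho) -/(partial l rho p).
by move: l; apply: ord4_ind; rewrite ?r0 ?r1 ?r2 ?r3 scaler0.
Qed.

End Boundary.

(** * The equivalence between regularity and the boundary condition *)

Unset Implicit Arguments.

Theorem corollary3 (R : realType) (Omega : set (quat R)) (rho : quat R -> R)
    (f : quat R -> quat R)
    (Omega_domain : domain Omega) (Omega_bounded : bounded_set Omega)
    (rho_def : C1_defining_function Omega rho)
    (f_harmonic : harmonic_on Omega f) (f_C1 : C1_on_closure Omega f) :
  regular_on Omega f <->
  (forall p, boundary Omega p ->
     opN Omega rho f p - qj R * opT Omega rho f p = 0).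
Proof.
have [oO _ _] := Omega_domain.
have [C1f _ ext] := f_C1.
have [[drho _] _ grad_rho] := rho_def.
(* The four chosen extensions combine into [G], a continuous extension of Df to the closure. *)
have /choice[v vP] : forall l : 'I_4, exists v : quat R -> quat R,
    {within closure Omega, continuous v} /\
    forall x, Omega x -> v x = partial l f x.
  by move=> l; have [v cv vE] := ext l; exists v.
pose G x := fueter_form (fun l => v l x).
have GE x : Omega x -> G x = fueter f x.
  by move=> Ox; rewrite /G /fueter_form /fueter !(vP _).2.
have bE p : boundary Omega p ->
    (opN Omega rho f p - qj R * opT Omega rho f p = 0 <-> G p = 0).
  move=> bp; have [clp _] := bp.
  rewrite boundary_operatorE.
  rewrite (_ : fueter_form _ = G p); last first.
    rewrite /G; congr fueter_form; apply/funext => l.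
    have [cv vE] := vP l.
    by apply: quat4P; rewrite coord_mkquat;
      exact: (partial_closure_coord _ C1f cv vE clp).
  split=> [bd|->]; last by rewrite !mulr0.
  have [w wp] := grad_rho p bp.
  have bd' := conj_mul_eq0 _ bd.
  (* The scalar factor one half is cancelled by the same lemma, as a quaternion with zero imaginary
     part. *)
  have := @conj_mul_eq0 R 2^-1 0 0 0 (G p); rewrite !oppr0; apply.
    by rewrite invr_eq0 pnatr_eq0.
  apply: bd'.
  have := gradient_neq0 (drho p I) wp.
  by rewrite !mulf_eq0 invr_eq0 pnatr_eq0 !orbF.
have cG m : {within closure Omega, continuous (fun x => coord m (G x))}.
  have [c [s cs]] := coord_fueter_form R m.
  rewrite (_ : (fun x => _) = fun x => \sum_l c l * coord (s l) (v l x)); last first.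
    by apply/funext => x; rewrite /G cs.
  move=> x; apply: (@continuous_lincomb R (subspace (closure Omega))) => l.
  apply: (@continuous_comp (subspace (closure Omega)) _ _ (v l)).
    exact: (vP l).1.
  exact: continuous_coord.
split=> [[_ reg] p bp|bd].
  (* A boundary value of [G] is a limit from inside [Omega], where [G] is Df and hence zero. *)
  apply/bE => //; apply: quatP => m.
  have [clp _] := bp.
  have PF := within_nbhs_proper clp.
  apply: (cvg_unique _ (cvg_within_closure (cG m) clp)) => //.
  apply: (@cvg_within_eq _ _ _ (fun=> coord m 0)); last exact: cvg_cst.
  by move=> x Ox; rewrite GE// reg.
split=> // p Op; rewrite -GE//; apply: quatP => m.
rewrite [RHS]mxE.
have [c [s cs]] := coord_fueter_form R m.
have hh l := harmonic_on_coord (s l) oO f_harmonic.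
have Gb x : boundary Omega x -> coord m (G x) = 0.
  by move=> bx; rewrite ((bE x bx).1 (bd x bx)) /coord mxE.
have GO x : Omega x ->
    coord m (G x) = \sum_l c l * partial l (fun y => coord (s l) (f y)) x.
  move=> Ox; rewrite /G cs; apply: eq_bigr => l _.
  by rewrite (vP l).2// partial_coord//; exact: C1f.1.
(* The maximum principle bounds the coordinate above by 0; with the coefficients negated it bounds
   its opposite, which gives the other inequality. *)
apply/eqP; rewrite eq_le; apply/andP; split.
  apply: (max_principle (c := c) oO Omega_bounded hh (cG m) GO _ Op).
  by move=> x bx; rewrite Gb.
rewrite -oppr_le0.
have cNG : {within closure Omega, continuous (fun x => - coord m (G x))}.
  by move=> x; apply: cvgN; exact: cG.
apply: (max_principle (c := fun l => - c l) oO Omega_bounded hh cNG _ _ Op) => x.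
  by move=> Ox; rewrite GO// -sumrN; apply: eq_bigr => l _; rewrite mulNr.
by move=> bx; rewrite Gb// oppr0.
Qed.
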